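(* Let $m\ge2$ and $n\ge1$ be integers and let $\mathcal{A}$ be a real centrosymmetric tensor of order $m$ and dimension $n$. If $\mathcal{A}$ has a real left inverse of order $2$ and dimension $n$ (i.e. there is a real $n\times n$ matrix $B$ with $B\mathcal{A}=\mathcal{I}$), then this order $2$ real left inverse is unique and it is centrosymmetric.
   Context: Write $[n]=\{1,\dots,n\}$. A real tensor of order $m$ and dimension $n$ is an array $\mathcal{A}=(a_{i_1\cdots i_m})$ of reals with $i_1,\dots,i_m\in[n]$; an order 2 tensor is an $n\times n$ matrix. It is centrosymmetric if $a_{i_1\cdots i_m}=a_{n-i_1+1,\dots,n-i_m+1}$ for all indices. For a matrix $B=(b_{ij})$ the product $B\mathcal{A}$ is the tensor of order $m$ and dimension $n$ with entries $(B\mathcal{A})_{i_1\cdots i_m}=\sum_{j\in[n]}b_{i_1j}a_{ji_2\cdots i_m}$. $\mathcal{I}=(\delta_{i_1\cdots i_m})$ is the identity tensor of order $m$ and dimension $n$: $\delta_{i_1\cdots i_m}=1$ if $i_1=\cdots=i_m$ and $0$ otherwise. $B$ is an order 2 left inverse of $\mathcal{A}$ if $B\mathcal{A}=\mathcal{I}$. *)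

(* Defs.v *)
From mathcomp Require Import all_boot all_order all_algebra.
From mathcomp Require Import reals.

Set Implicit Arguments.
Unset Strict Implicit.
Unset Printing Implicit Defensive.

Import GRing.Theory.
Local Open Scope ring_scope.

(* Indices are 0-based: 'I_n = {0, ..., n-1} stands for [n] = {1, ..., n}. *)
Definition tensor (R : realType) (m n : nat) : Type :=
  {ffun m.-tuple 'I_n -> R}.

Section Tensors.
Variables (R : realType) (n : nat).

Definition tensor_of_mx (B : 'M[R]_n) : tensor R 2 n :=
  [ffun i : 2.-tuple 'I_n => B (tnth i ord0) (tnth i ord_max)].

(* In 0-based indexing i |-> n - i + 1 becomes i |-> n - 1 - i, i.e. rev_ord. *)
Definition centrosymmetric (m : nat) (A : tensor R m n) : Prop :=
  forall i : m.-tuple 'I_n, A i = A [tuple of map (@rev_ord n) i].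

(* The product acts on the first index, so the order has to be positive. *)
Definition mx_mul_tensor (m : nat) (B : 'M[R]_n) (A : tensor R m.+1 n) :
    tensor R m.+1 n :=
  [ffun i : m.+1.-tuple 'I_n =>
    \sum_(j < n) B (thead i) j * A [tuple of j :: behead i]].

Definition id_tensor (m : nat) : tensor R m n :=
  [ffun i : m.-tuple 'I_n => (constant i)%:R].

Definition order2_left_inverse (m : nat) (A : tensor R m.+1 n)
    (B : 'M[R]_n) : Prop :=
  mx_mul_tensor B A = id_tensor m.+1.

End Tensors.

(* Main.v *)
(** Restricting the last [m - 1] indices of [A] to the diagonal gives the square
    matrix [C j k = a_(j k ... k)].  The equation [B A = I] yields [B C = 1], and
    a left inverse of a square matrix is unique.  When [A] is centrosymmetric so
    is [C], hence the matrix obtained from [B] by reversing rows and columns is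
    also a left inverse of [C]. *)
Require Import Defs.
From mathcomp Require Import all_boot all_order all_algebra.
From mathcomp Require Import reals.

Import GRing.Theory.
Local Open Scope ring_scope.

Definition majorization_mx {R : realType} {m n : nat} (A : tensor R m.+1 n) :
    'M[R]_n :=
  \matrix_(j, k) A [tuple of j :: nseq m k].

Lemma mul_majorization_mx {R : realType} {m n : nat} {A : tensor R m.+2 n}
    {B : 'M[R]_n} :
  order2_left_inverse A B -> B *m majorization_mx A = 1%:M.
Proof.
move=> hB; apply/matrixP => i k; rewrite !mxE.
have /ffunP/(_ [tuple of i :: nseq m.+1 k]) := hB; rewrite !ffunE.
(* At least one [k] follows [i], since the order is at least 2; a 1-tuple would be constant whatever
   [k] is. *)
have -> : constant [tuple of i :: nseq m.+1 k] = (i == k).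
  by rewrite /= all_nseq /= eq_sym; case: (i == k); rewrite ?orbT.
move=> <-; apply: eq_bigr => j _; rewrite mxE theadE.
by congr (_ * A _); apply: val_inj.
Qed.

Lemma majorization_mx_rev {R : realType} {m n : nat} {A : tensor R m.+1 n}
    (j k : 'I_n) :
  centrosymmetric A ->
  majorization_mx A (rev_ord j) (rev_ord k) = majorization_mx A j k.
Proof.
move=> hA; rewrite !mxE [RHS]hA; congr (A _); apply: val_inj.
by rewrite /= map_nseq.
Qed.

(** With $J$ the reversal permutation matrix, $C = JCJ$ and $J^2 = 1$ give $(JBJ)C = J(BC)J = 1$. *)
Lemma mulmx_rev_eq1 {R : pzRingType} {n : nat} {B C : 'M[R]_n} :
  (forall j k, C (rev_ord j) (rev_ord k) = C j k) ->
  B *m C = 1%:M -> (\matrix_(i, j) B (rev_ord i) (rev_ord j)) *m C = 1%:M.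
Proof.
move=> hC hBC; apply/matrixP => i k; rewrite !mxE.
have /matrixP/(_ (rev_ord i) (rev_ord k)) := hBC.
rewrite !mxE (inj_eq rev_ord_inj) => <-.
rewrite [RHS](reindex_inj rev_ord_inj); apply: eq_bigr => j _.
by rewrite mxE hC.
Qed.

(** By commutativity of [R], [B *m C = 1%:M] forces [C *m B = 1%:M], so $B = B'CB = B'$. *)
Lemma left_inverse_mx_unique {R : comNzRingType} {n : nat} {B B' C : 'M[R]_n} :
  B *m C = 1%:M -> B' *m C = 1%:M -> B = B'.
Proof.
by move=> hB hB'; rewrite -[B]mul1mx -hB' -mulmxA (mulmx1C hB) mulmx1.
Qed.

Theorem theorem3p9 (R : realType) (m n : nat) (hn : (1 <= n)%N)
    (A : tensor R m.+2 n) (hA : centrosymmetric A) (B : 'M[R]_n)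
    (hB : order2_left_inverse A B) :
  unique (order2_left_inverse A) B /\ centrosymmetric (tensor_of_mx B).
Proof.
have hBC := mul_majorization_mx hB; split.
  by split=> // B' /mul_majorization_mx; apply: left_inverse_mx_unique hBC.
have hC j k := majorization_mx_rev j k hA.
have eqB := left_inverse_mx_unique hBC (mulmx_rev_eq1 hC hBC).
(* Only the left-hand [B] is rewritten, as [B] occurs on both sides of [eqB]. *)
by move=> i; rewrite !ffunE !tnth_map {1}eqB mxE.
Qed.
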